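(* Let $G$ be a countably infinite amenable cancellative semigroup and let $\Phi=(\Phi_n)$ be a Følner sequence in $G$. The set of $\Phi$-ENA elements of $\{0,1\}^G$ is comeager in $\{0,1\}^G$.
   Context: The space $\{0,1\}^G$ carries the product topology; a subset is comeager if its complement is a countable union of nowhere dense sets. A (left) Følner sequence in $G$ is a sequence $\Phi=(\Phi_n)$ of nonempty finite subsets of $G$ with $\lim_{n\to\infty}|\Phi_n\cap g\Phi_n|/|\Phi_n|=1$ for every $g\in G$; amenability of $G$ is equivalent to existence of such a sequence. For a nonempty finite $K\subseteq G$ and a finite $X\subseteq G$, let $\mathcal{Y}_{K,X}$ be the collection of those sets $Y\subseteq X$ that satisfy $KY\subseteq X$ and $Ky\cap Kz=\varnothing$ for all distinct $y,z\in Y$, and that have maximal cardinality among all subsets of $X$ with these properties. For $\omega\in\{0,1\}^K$ and $\alpha\in\{0,1\}^G$ define $$\overline{d}_\Phi(K,\omega,\alpha)=\limsup_{n\to\infty}\max_{Y\in\mathcal{Y}_{K,\Phi_n}}\frac{|\{y\in Y:\alpha(hy)=\omega(h)\text{ for all }h\in K\}|}{|Y|},$$ and let $\underline{d}_\Phi(K,\omega,\alpha)$ be the corresponding $\liminf$ (of the same maximum). These are well defined since $\mathcal{Y}_{K,\Phi_n}=\{\varnothing\}$ for only finitely many $n$ (those $n$ are ignored). An element $\alpha\in\{0,1\}^G$ is $\Phi$-ENA (extremely non-averageable) if $\overline{d}_\Phi(K,\omega,\alpha)=1$ and $\underline{d}_\Phi(K,\omega,\alpha)=0$ for every nonempty finite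 $K\subseteq G$ and every $\omega\in\{0,1\}^K$. *)

(* Defs.v *)
From HB Require Import structures.
From mathcomp Require Import all_boot all_order all_algebra monoid finmap.
From mathcomp Require Import all_classical all_reals all_analysis.
Import Order.TTheory GRing.Theory Num.Theory.
Import numFieldNormedType.Exports.

Set Implicit Arguments.
Unset Strict Implicit.
Unset Printing Implicit Defensive.

Local Open Scope classical_set_scope.
Local Open Scope fset_scope.
Local Open Scope ring_scope.

Definition nowhere_dense (T : topologicalType) (A : set T) : Prop :=
  interior (closure A) = set0.

Definition comeager (T : topologicalType) (A : set T) : Prop :=
  exists N : nat -> set T,
    (forall n, nowhere_dense (N n)) /\ ~` A = \bigcup_n N n.

Definition cancellative (G : semigroupType) : Prop :=
  right_injective (fun x y : G => (x * y)%g) /\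
  left_injective (fun x y : G => (x * y)%g).

Definition is_mean (R : realType) (T : Type) (m : (T -> R) -> R) : Prop :=
  [/\ forall (a : R) (f g : T -> R), bounded_fun f -> bounded_fun g ->
        m (fun x => a * f x + g x) = a * m f + m g,
      forall f : T -> R, bounded_fun f -> (forall x, 0 <= f x) -> 0 <= m f &
      m (fun=> 1) = 1].

(* Left amenability.  As means are only constrained on bounded functions, the
   values of m elsewhere are junk. *)
Definition amenable (R : realType) (G : semigroupType) : Prop :=
  exists m : (G -> R) -> R, is_mean m /\
    forall (g : G) (f : G -> R), bounded_fun f ->
      m (fun x => f (g * x)%g) = m f.

Definition is_Folner (R : realType) (G : semigroupType)
    (Phi : nat -> {fset G}) : Prop :=
  (forall n, Phi n != fset0) /\
  forall g : G,
    (#|` Phi n `&` [fset (g * x)%g | x in Phi n]|%:R / #|` Phi n|%:R : R)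
      @[n --> \oo] --> (1 : R).

Definition packing (G : semigroupType) (K X Y : {fset G}) : bool :=
  [&& Y `<=` X,
      [fset (k * y)%g | k in K, y in Y] `<=` X &
      [forall y : Y, forall z : Y, (val y != val z) ==>
        [disjoint [fset (k * val y)%g | k in K]
                & [fset (k * val z)%g | k in K]]%fset]].

Definition max_packings (G : semigroupType) (K X : {fset G}) :
    {fset {fset G}} :=
  [fset Y in fpowerset X | packing K X Y &&
    [forall Z : fpowerset X, packing K X (val Z) ==> (#|` val Z| <= #|` Y|)%N]].

Definition occurrences (G : semigroupType) (K : {fset G})
    (w : {ffun K -> bool}) (alpha : G -> bool) (Y : {fset G}) : {fset G} :=
  [fset y in Y | [forall h : K, alpha (val h * y)%g == w h]].

(* The default 0 of the maximum is harmless: max_packings K X contains a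
   packing and the ratios are nonnegative.  When fset0 is the only packing the
   ratio is 0 / 0 = 0; along a Folner sequence this happens for finitely many
   indices only, so these affect neither the limsup nor the liminf below. *)
Definition max_freq (R : realType) (G : semigroupType) (K : {fset G})
    (w : {ffun K -> bool}) (alpha : G -> bool) (X : {fset G}) : R :=
  \big[Order.max/0]_(Y <- max_packings K X)
    (#|` occurrences w alpha Y|%:R / #|` Y|%:R).

Definition upper_density (R : realType) (G : semigroupType)
    (Phi : nat -> {fset G}) (K : {fset G}) (w : {ffun K -> bool})
    (alpha : G -> bool) : \bar R :=
  limn_esup (fun n => (max_freq R w alpha (Phi n))%:E).

Definition lower_density (R : realType) (G : semigroupType)
    (Phi : nat -> {fset G}) (K : {fset G}) (w : {ffun K -> bool})
    (alpha : G -> bool) : \bar R :=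
  limn_einf (fun n => (max_freq R w alpha (Phi n))%:E).

Definition ENA (R : realType) (G : semigroupType) (Phi : nat -> {fset G})
    (alpha : G -> bool) : Prop :=
  forall (K : {fset G}) (w : {ffun K -> bool}), K != fset0 ->
    upper_density R Phi w alpha = 1%E /\ lower_density R Phi w alpha = 0%E.

(* Main.v *)
Require Import Defs.
From mathcomp Require Import all_boot all_order all_algebra monoid finmap.
From mathcomp Require Import all_classical all_reals all_analysis.
Import Order.TTheory GRing.Theory Num.Theory.

Local Open Scope classical_set_scope.

(** Being extremely non-averageable is a conjunction of countably many conditions,
    each of which asks that some event, depending on finitely many coordinates at
    each time, happen infinitely often. Fix K and w. The upper density is 1 as
    soon as, for each j, infinitely many n satisfy max_freq > 1 - 1 / (j + 1);
    the lower density is 0 as soon as, for each j, infinitely many n satisfy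
    max_freq < 1 / (j + 1). There are countably many triples (K, w, j), because G
    is countable, so by [comeager_bigcap] and [comeager_frequently] it is enough
    to realise each of these inequalities at some late n while keeping the values
    of a given configuration on a given finite set F.

    The point is that the maximal packings Y of Phi n by translates of K grow
    without bound ([Folner_large_packings]), while at most #|F| of the disjoint
    translates K y can hit F ([card_hitting_points]). Off F the configuration is
    free. Writing w on all the translates of one maximal packing gives a frequency
    of at least 1 - #|F| / #|Y| ([planting]). Taking off F a constant value which
    disagrees with w at one point of K leaves, in every packing at once, at most
    #|F| occurrences ([avoiding]), hence a frequency of at most #|F| / #|Y|.

    The growth of the packings uses only thickness: for each finite L, eventually
    L a is contained in Phi n for some a in Phi n ([Folner_thick]). An infinite
    cancellative semigroup contains arbitrarily many disjoint translates of K
    ([exists_disjoint_translates]), and right translation by a carries them into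
    Phi n. *)

(** * Comeager sets *)

Section Comeager.
Context {T : topologicalType}.

Lemma comeagerS (A B : set T) : A `<=` B -> comeager A -> comeager B.
Proof.
(* The union must equal the complement of B, so the cover is cut down to it. *)
move=> AB [N [Nnd AN]]; exists (fun n => N n `&` ~` B); split=> [n|].
  rewrite /nowhere_dense -subset0 -(Nnd n).
  by apply: interiorS; apply: closureS; exact: subIsetl.
rewrite -setI_bigcupl -AN eqEsubset; split=> x; last by case.
by move=> Bx; split=> // /AB.
Qed.

(** The complement of an open dense set is closed with empty interior, hence
    is its own witness of meagerness. *)
Lemma comeager_open_dense (A : set T) : open A -> dense A -> comeager A.
Proof.
move=> oA dA; exists (fun=> ~` A); split=> [_|]; last first.
  by rewrite eqEsubset; split=> [x Ax|x [n _]//]; exists 0%N.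
rewrite /nowhere_dense closure_setC ((interior_id _).1 oA) interiorC.
rewrite -subset0 => x /= ncx; apply: ncx => B nBx.
have [y [By Ay]] : B° `&` A !=set0.
  by apply: dA; [exists x | exact: open_interior].
by exists y; split=> //; exact: interior_subset By.
Qed.

(** A countable union of countable unions is countable: the pairs (index,
    position in the cover of that index) are encoded by natural numbers, and
    the numbers which encode nothing receive the empty set. *)
Lemma comeager_bigcap (I : Type) (A : I -> set T) :
  countable [set: I] -> (forall i, comeager (A i)) -> comeager (\bigcap_i A i).
Proof.
move=> /countable_injP[f f_inj] /choice[N HN].
pose code (i : I) (k : nat) := choice.pickle (f i, k).
pose M m : set T := [set x | exists i k, code i k = m /\ N i k x].
exists M; split=> [m|].
  have [[i [k eqm]]|nom] := pselect (exists i k, code i k = m).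
    have -> : M m = N i k.
      rewrite eqEsubset; split=> [x [j [l [eqm']]]|x Nx]; last by exists i, k.
      have /(pcan_inj choice.pickleK)[fij ->] : code j l = code i k.
        by rewrite eqm eqm'.
      by have -> : j = i by apply: f_inj; rewrite ?inE.
    exact: (HN i).1.
  have -> : M m = set0.
    by rewrite -subset0 => x [i [k [eqm _]]]; apply: nom; exists i, k.
  by rewrite /nowhere_dense closure0 interior0.
rewrite setC_bigcap eqEsubset; split=> [x [i _]|x [m _ [i [k [_ Nx]]]]].
  by rewrite (HN i).2 => -[k _ Nx]; exists (code i k) => //; exists i, k.
by exists i => //; rewrite (HN i).2; exists k.
Qed.

Lemma comeagerI (A B : set T) : comeager A -> comeager B -> comeager (A `&` B).
Proof.
move=> cA cB; rewrite (_ : A `&` B = \bigcap_b (if b then A else B)).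
  by apply: comeager_bigcap => [|[]]; first exact: countableP.
rewrite eqEsubset; split=> [x [Ax Bx] []//|x ABx].
by split; [exact: (ABx true) | exact: (ABx false)].
Qed.

End Comeager.

(** * Comeager sets of binary configurations *)

Section Cylinders.
Context {I : choiceType}.
Implicit Types (a b : I -> bool) (F : {fset I}).
Local Notation space := (prod_topology (fun _ : I => bool)).

(** A cylinder is a finite intersection of preimages of points under the
    continuous coordinate maps into a discrete space. *)
Lemma nbhs_cylinder a F :
  nbhs (a : space) [set b | forall x, x \in F -> a x = b x].
Proof.
have -> : [set b : space | forall x, x \in F -> a x = b x] =
    \bigcap_(x in [set` F]) [set b : space | a x = b x].
  by rewrite eqEsubset; split=> b Hb x; apply: Hb.
apply: filter_bigI => x _.
have /= := @proj_continuous I (fun=> bool) x (a : space) [set y | a x = y].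
by apply; rewrite nbhs_principalE; apply/principal_filterP.
Qed.

(** The cylinders around a generate a filter which converges to a coordinate by
    coordinate, hence in the product topology, so every neighbourhood of a
    belongs to that filter. *)
Lemma cylinder_nbhs a (A : set space) : nbhs (a : space) A ->
  exists F, [set b | forall x, x \in F -> a x = b x] `<=` A.
Proof.
pose cyl F : set space := [set b | forall x, x \in F -> a x = b x].
have FF : Filter (filter_from setT cyl).
  apply: filter_from_filter; first by exists fset0.
  move=> E F _ _; exists (E `|` F)%fset => // b Hb; split=> x xF; apply: Hb;
  by rewrite inE xF ?orbT.
suff: filter_from setT cyl --> (a : space) by move=> H /H[F _ HF]; exists F.
apply/cvg_sup => i; apply/cvg_image => [|B /=].
  rewrite eqEsubset; split=> // c _; exists (fun=> c) => //.
rewrite nbhs_principalE => /principal_filterP Ba.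
exists [set b : space | B (b i)].
  by exists [fset i]%fset => // b Hb /=; rewrite -Hb ?inE.
rewrite eqEsubset; split=> [_ [b Bb <-]//|c Bc].
by exists (fun=> c).
Qed.

(** For each N, the configurations for which P holds at some time after N form a
    set which is open since P n is determined by finitely many coordinates, and
    dense since P can be forced late while respecting any given cylinder. *)
Lemma comeager_frequently (P : nat -> (I -> bool) -> Prop) :
    (forall n, exists F, forall a b,
      (forall x, x \in F -> a x = b x) -> P n a -> P n b) ->
    (forall a F N, exists2 b, forall x, x \in F -> a x = b x &
      exists2 n, (N <= n)%N & P n b) ->
  comeager ([set a | forall N, exists2 n, (N <= n)%N & P n a] : set space).
Proof.
move=> Ploc Pdense.
have -> : [set a : space | forall N, exists2 n, (N <= n)%N & P n a] =
    \bigcap_N [set a : space | exists2 n, (N <= n)%N & P n a].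
  by rewrite eqEsubset; split=> [a Ha N _|a Ha N]; apply: Ha.
apply: comeager_bigcap => [|N]; first exact: countableP.
apply: comeager_open_dense.
  rewrite openE => a [n Nn Pa]; have [F HF] := Ploc n.
  by apply: filterS (nbhs_cylinder a F) => b Hb; exists n => //; exact: HF Pa.
move=> O [a Oa] oO.
have /cylinder_nbhs[F HF] : nbhs (a : space) O by exact: open_nbhs_nbhs.
by have [b ab Pb] := Pdense a F N; exists b; split=> //; exact: HF.
Qed.

End Cylinders.

Lemma countable_fsetT {T : choiceType} :
  countable [set: T] -> countable [set: {fset T}].
Proof.
move=> /countable_finite_subset/countable_injP[f f_inj].
apply/countable_injP; exists (fun A => f [set` A]) => A B _ _ fAB.
rewrite -(set_fsetK A) -(set_fsetK B); congr (fset_set _).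
by apply: f_inj => //; rewrite inE; split.
Qed.

(** * Limit superior and limit inferior *)

Section LimsupLiminf.
Context {R : realType}.
Local Open Scope ring_scope.

(** The slack 1 / (j + 1) turns the value of a limit superior into countably many
    conditions on infinitely many terms, the shape needed for genericity. *)
Lemma limn_esup_eq (u : nat -> R) (l : R) : (forall n, u n <= l) ->
    (forall j N, exists2 n, (N <= n)%N & l - j.+1%:R^-1 < u n) ->
  limn_esup (fun n => (u n)%:E) = l%:E.
Proof.
move=> ul ufreq; apply/eqP; rewrite eq_le; apply/andP; split.
  apply: ereal_inf_lbound; exists setT; first exact: filterT.
  apply/eqP; rewrite eq_le; apply/andP; split.
    by apply: ge_ereal_sup => _ [n _ <-]; rewrite lee_fin.
  apply/lee_subgt0Pr => e e0.
  have [j je] : exists j, j.+1%:R^-1 < e.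
    by have [j _ /(_ j (leqnn j))] := near_infty_natSinv_lt (PosNum e0); exists j.
  have [n _ ln] := ufreq j 0%N.
  apply: (@le_trans _ _ (u n)%:E); last by apply: ereal_sup_ubound; exists n.
  rewrite -EFinB lee_fin; apply: ltW; apply: lt_trans ln.
  by rewrite ltrD2l ltrN2.
apply: le_ereal_inf_tmp => _ [V [N _ NV] <-]; apply/lee_subgt0Pr => e e0.
have [j je] : exists j, j.+1%:R^-1 < e.
  by have [j _ /(_ j (leqnn j))] := near_infty_natSinv_lt (PosNum e0); exists j.
have [n Nn ln] := ufreq j N.
apply: (@le_trans _ _ (u n)%:E).
  rewrite -EFinB lee_fin; apply: ltW; apply: lt_trans ln.
  by rewrite ltrD2l ltrN2.
by apply: ereal_sup_ubound; exists n => //; exact: NV.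
Qed.

Lemma limn_einf_eq (u : nat -> R) (l : R) : (forall n, l <= u n) ->
    (forall j N, exists2 n, (N <= n)%N & u n < l + j.+1%:R^-1) ->
  limn_einf (fun n => (u n)%:E) = l%:E.
Proof.
move=> lu ufreq; apply: oppe_inj; rewrite -limn_esupN.
apply: (@limn_esup_eq (fun n => - u n) (- l)) => [n|j N]; first by rewrite lerN2.
by have [n Nn un] := ufreq j N; exists n; rewrite // -opprD ltrN2.
Qed.

End LimsupLiminf.

(** * Packings by translates *)

Section Packings.
Context {G : semigroupType}.
Implicit Types (K X Y F D : {fset G}).
Local Open Scope group_scope.

(** The elementwise contrapositive of the disjointness of K y and K z for
    distinct y and z: the form in which cancellation applies to it. *)
Definition disjoint_translates K Y := forall y z k l : G,
  y \in Y -> z \in Y -> k \in K -> l \in K -> k * y = l * z -> y = z.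

Lemma packingP K X Y : reflect
  [/\ {subset Y <= X}, (forall k y, k \in K -> y \in Y -> k * y \in X) &
      disjoint_translates K Y] (packing K X Y).
Proof.
apply: (iffP and3P) => -[YX KYX sep]; split.
- exact/fsubsetP.
- by move=> k y kK yY; apply: (fsubsetP KYX); apply: in_imfset2.
- move=> y z k l yY zY kK lK kylz; apply/eqP; apply: contraT => yz.
  move: sep => /forallP/(_ [` yY]%fset)/forallP/(_ [` zY]%fset)/implyP/(_ yz).
  move=> /fdisjointP/(_ (k * y)) /= => /(_ (in_imfset _ _ kK))/negP[].
  by rewrite kylz; apply: (in_imfset _ (fun k => k * z)).
- exact/fsubsetP.
- by apply/fsubsetP => _ /imfset2P[k kK [y yY ->]]; exact: KYX.
- apply/forallP => -[y yY]; apply/forallP => -[z zY]; apply/implyP => /= yz.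
  apply/fdisjointP => _ /imfsetP[k /= kK ->]; apply/negP => /imfsetP[l /= lK].
  by move=> /(sep _ _ _ _ yY zY kK lK) /eqP; rewrite (negbTE yz).
Qed.

Lemma max_packingsP K X Y : reflect
  (packing K X Y /\ forall Z, packing K X Z -> (#|` Z| <= #|` Y|)%N)
  (Y \in max_packings K X).
Proof.
rewrite !inE /=; apply: (iffP and3P) => [[_ pY /forallP maxY]|[pY maxY]].
  split=> // Z pZ.
  have ZX : Z \in fpowerset X by rewrite fpowersetE; case/and3P: pZ.
  by have /implyP/(_ pZ) := maxY [` ZX]%fset.
split=> //; first by rewrite fpowersetE; case/and3P: pY.
by apply/forallP => Z; apply/implyP => /maxY.
Qed.

(** fset0 is a packing, and the packings of X range over the finite
    fpowerset X. *)
Lemma max_packings_nonempty K X : exists Y, Y \in max_packings K X.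
Proof.
have p0 : packing K X fset0.
  by apply/packingP; split=> // y; rewrite ?inE.
have X0 : fset0 \in fpowerset X by rewrite fpowersetE fsub0set.
case: (@arg_maxnP _ [` X0]%fset (fun Z => packing K X (val Z))
  (fun Z => #|` val Z|) p0) => Y pY maxY.
exists (val Y); apply/max_packingsP; split=> // Z pZ.
have ZX : Z \in fpowerset X by rewrite fpowersetE; case/and3P: pZ.
exact: (maxY [` ZX]%fset).
Qed.

Definition hitting_points K Y F : {fset G} :=
  [fset y in Y | [exists k : K, val k * y \in F]]%fset.

(** Choosing in F a point of each translate that hits F is injective, as the
    translates are disjoint. This is why changing a configuration on F alone
    matters little to large packings. *)
Lemma card_hitting_points K Y F : disjoint_translates K Y ->
  (#|` hitting_points K Y F| <= #|` F|)%N.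
Proof.
move=> sep.
pose f y := if [pick k : K | val k * y \in F] is Some k then val k * y else y.
have fP y : y \in hitting_points K Y F ->
    exists2 k, k \in K & f y = k * y /\ f y \in F.
  rewrite !inE => /andP[_ /existsP[k kF]]; rewrite /f.
  by case: pickP => [l lF|/(_ k)]; [exists (val l) => //; exact: valP | rewrite kF].
have hitY y : y \in hitting_points K Y F -> y \in Y by rewrite !inE => /andP[].
have f_inj : {in hitting_points K Y F &, injective f}.
  move=> y z yM zM; have [k kK [-> _]] := fP y yM; have [l lK [-> _]] := fP z zM.
  exact: sep (hitY _ yM) (hitY _ zM) kK lK.
rewrite -(card_in_imfset imfset_key f_inj); apply/fsubset_leq_card/fsubsetP.
by move=> _ /imfsetP[y yM ->]; have [k _ []] := fP y yM.
Qed.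

(** Greedy choice: by left cancellation only finitely many g have k * g in the
    finite set already covered for some k in K, and G is infinite. *)
Lemma exists_disjoint_translates K m : cancellative G -> infinite_set [set: G] ->
  exists2 D, #|` D| = m & disjoint_translates K D.
Proof.
move=> [mulI _] infG; elim: m => [|m [D Dm sep]].
  by exists fset0; rewrite ?cardfs0 // => y z k l; rewrite inE.
pose KD := [fset (k * y)%g | k in K, y in D]%fset.
pose bad := [set` D] `|` \bigcup_(k in [set` K]) ((fun z => k * z) @^-1` [set` KD]).
have finbad : finite_set bad.
  rewrite finite_setU; split; first exact: finite_fset.
  apply: bigcup_finite => [|k _]; first exact: finite_fset.
  by apply: finite_preimage; [move=> x y _ _; exact: mulI | exact: finite_fset].
have /infinite_setN0[g [_ gbad]] := infinite_setD infG finbad.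
have gD : g \notin D by apply/negP => gD; apply: gbad; left.
have gK k l y : k \in K -> l \in K -> y \in D -> k * g <> l * y.
  move=> kK lK yD eqg; apply: gbad; right; exists k => //=.
  by rewrite eqg; apply: in_imfset2.
exists (g |` D)%fset; first by rewrite cardfsU1 gD Dm.
move=> y z k l; rewrite !inE => /orP[/eqP->|yD] /orP[/eqP->|zD] kK lK //.
- by move/gK; case.
- by move/esym/gK; case.
- exact: sep.
Qed.

End Packings.

(** * Packings of Følner sets *)

Section Folner.
Context {R : realType} {G : semigroupType} {Phi : nat -> {fset G}}.
Context (Phi_Folner : is_Folner R Phi).
Local Open Scope ring_scope.

Let escaping n (L : seq G) :=
  [fset a in Phi n | ~~ all (fun l => (l * a)%g \in Phi n) L]%fset.

Let card_Phi_gt0 n : 0 < #|` Phi n|%:R :> R.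
Proof. by rewrite ltr0n cardfs_gt0; exact: Phi_Folner.1. Qed.

(** For a single l, at most #|Phi n| - #|Phi n :&: l Phi n| points are moved
    out of Phi n by l, which is a small proportion of Phi n; a finite set L
    is treated by splitting e in halves. *)
Lemma Folner_few_escape (L : seq G) (e : R) : 0 < e ->
  \forall n \near \oo, #|` escaping n L|%:R < e * #|` Phi n|%:R.
Proof.
elim: L e => [|l L IH] e e0.
  apply: nearW => n; rewrite (_ : escaping n [::] = fset0); last first.
    by apply/fsetP => a; rewrite !inE andbF.
  by rewrite cardfs0 mulr_gt0.
have e2 : 0 < e / 2 by rewrite divr_gt0.
have /cvgrPdist_lt/(_ _ e2) := Phi_Folner.2 l.
apply: filterS2 (IH _ e2) => n badL.
set X := Phi n in badL *; set I := (_ `&` _)%fset => closeI.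
pose E := [fset a in X | (l * a)%g \notin X]%fset.
have EX : (E `<=` X)%fset by apply/fsubsetP => a; rewrite !inE => /andP[].
have cI : (#|` I| + #|` E| <= #|` X|)%N.
  rewrite -(cardfsID E X) (fsetIidPr EX) addnC leq_add2l.
  apply: leq_trans
    (leq_imfset_card imfset_key (fun x => (l * x)%g) (mem (X `\` E)%fset)).
  apply/fsubset_leq_card/fsubsetP => x /fsetIP[xX /imfsetP[a /= aX eq_x]].
  move: xX; rewrite {}eq_x => laX.
  apply/imfsetP; exists a => //=.
  by rewrite !inE aX laX.
have cE : #|` E|%:R < e / 2 * #|` X|%:R.
  have X0 := card_Phi_gt0 n.
  move: closeI; rewrite -/I => /(le_lt_trans (ler_norm _)).
  rewrite -(ltr_pM2r X0) mulrBl mul1r divfK ?gt_eqF //.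
  apply: le_lt_trans; rewrite lerBrDr -natrD ler_nat addnC.
  exact: cI.
have cB : (#|` escaping n (l :: L)| <= #|` E| + #|` escaping n L|)%N.
  apply: leq_trans (leq_of_leqif (leq_card_fsetU _ _)).
  apply/fsubset_leq_card/fsubsetP => a; rewrite !inE /= negb_and.
  by move=> /andP[-> /orP[]->]; rewrite ?orbT.
apply: (@le_lt_trans _ _ (#|` E| + #|` escaping n L|)%:R); first by rewrite ler_nat.
rewrite natrD [X in _ < X * _](splitr e) mulrDl.
exact: ltrD.
Qed.

(** With e = 1, fewer than #|Phi n| points escape, so some point stays. *)
Lemma Folner_thick (L : {fset G}) : \forall n \near \oo,
  exists2 a, a \in Phi n & forall l, l \in L -> (l * a)%g \in Phi n.
Proof.
apply: filterS (Folner_few_escape L 1 ltr01) => n; rewrite mul1r ltr_nat => badL.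
have [a aX aB] : exists2 a, a \in Phi n & a \notin escaping n L.
  apply: contrapT => nex; move: badL; rewrite ltnNge => /negP; apply.
  apply/fsubset_leq_card/fsubsetP => a aX; apply: contrapT => /negP aB.
  by apply: nex; exists a.
exists a => // l lL; move: aB; rewrite !inE aX /= negbK => /allP; exact.
Qed.

(** Pick m disjoint translates K d of K in G and right translate the whole
    pattern into Phi n by thickness: right cancellation keeps the translates
    K d a disjoint and the points d a distinct. A packing of maximal cardinality
    is at least as large as the one so obtained. *)
Lemma Folner_large_packings (K : {fset G}) (m : nat) :
    cancellative G -> infinite_set [set: G] ->
  \forall n \near \oo, forall Y, Y \in max_packings K (Phi n) -> (m <= #|` Y|)%N.
Proof.
move=> cG infG; have [D <- sep] := exists_disjoint_translates K m cG infG.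
pose L := (D `|` [fset (k * y)%g | k in K, y in D])%fset.
apply: filterS (Folner_thick L) => n [a aX La] Y /max_packingsP[_ maxY].
have aI : injective (fun d => (d * a)%g) := @cG.2 a.
rewrite -(card_imfset imfset_key (mem D) aI); apply: maxY.
apply/packingP; split.
- by move=> _ /imfsetP[d /= dD ->]; apply: La; rewrite !inE dD.
- move=> k _ kK /imfsetP[d /= dD ->]; rewrite mulgA; apply: La.
  by rewrite inE; apply/orP; right; apply: in_imfset2.
- move=> _ _ k l /imfsetP[d /= dD ->] /imfsetP[f /= fD ->] kK lK.
  by rewrite !mulgA => /aI /(sep _ _ _ _ dD fD kK lK) ->.
Qed.

End Folner.

(** * Controlling frequencies off a finite set *)

Section Frequencies.
Context {R : realType} {G : semigroupType} {K : {fset G}} (w : {ffun K -> bool}).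
Implicit Types (X Y F : {fset G}) (a b : G -> bool).
Local Open Scope ring_scope.

Let freq a Y : R := #|` occurrences w a Y|%:R / #|` Y|%:R.

Lemma freq_le1 a Y : freq a Y <= 1.
Proof.
have [->|Y0] := eqVneq Y fset0; first by rewrite /freq cardfs0 invr0 mulr0.
rewrite ler_pdivrMr ?ltr0n ?cardfs_gt0 // mul1r ler_nat.
by apply/fsubset_leq_card/fsubsetP => y; rewrite !inE => /andP[].
Qed.

Lemma max_freq_ge0 a X : 0 <= max_freq R w a X.
Proof. exact: bigmax_ge_id. Qed.

Lemma max_freq_le1 a X : max_freq R w a X <= 1.
Proof. by apply: bigmax_le => // Y _; exact: freq_le1. Qed.

Lemma max_freq_local X : exists F, forall a b,
  (forall x, x \in F -> a x = b x) -> max_freq R w a X = max_freq R w b X.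
Proof.
exists [fset (k * y)%g | k in K, y in X]%fset => a b ab.
apply: eq_big_seq => Y /max_packingsP[/packingP[YX _ _] _].
congr (#|` _|%:R / _); apply/fsetP => y; rewrite !inE.
apply: andb_id2l => yY; apply: eq_forallb => h.
by rewrite ab //; apply: in_imfset2; [exact: valP | exact: YX].
Qed.

(** Writing w on each translate K y, outside of F, is consistent: the
    translates are disjoint, and within K y right cancellation recovers h from
    h * y. All occurrences are then realised except where K y hits F. *)
Lemma planting a F Y : cancellative G -> disjoint_translates K Y ->
  exists2 b, (forall x, x \in F -> a x = b x) &
    (#|` Y| <= #|` occurrences w b Y| + #|` F|)%N.
Proof.
move=> [_ mulI] sep.
pose b x := if x \in F then a x else
  [exists y : Y, [exists h : K, (x == val h * val y)%g && w h]].
exists b => [x xF|]; first by rewrite /b xF.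
have bw (h : K) y : y \in Y -> (val h * y)%g \notin F -> b (val h * y)%g = w h.
  move=> yY /negbTE hyF; rewrite /b hyF; apply/existsP/idP => [[[z zY]]|wh].
    move=> /existsP[l /andP[/eqP/= eql wl]].
    have yz : y = z by apply: sep eql => //; exact: valP.
    by move: eql; rewrite -yz => /mulI /val_inj ->.
  by exists [` yY]%fset; apply/existsP; exists h; rewrite eqxx.
apply: leq_trans (leq_add (leqnn _) (card_hitting_points K Y F sep)).
apply: leq_trans (leq_of_leqif (leq_card_fsetU _ _)).
apply/fsubset_leq_card/fsubsetP => y yY; rewrite !inE yY /=.
case: existsP => [|nohit]; first by rewrite orbT.
rewrite orbF; apply/forallP => h; apply/eqP; apply: bw => //.
by apply/negP => hyF; apply: nohit; exists h.
Qed.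

(** Off F the configuration is constant, with a value that w does not take at
    some fixed h; an occurrence of w at y then forces h * y into F. *)
Lemma avoiding a F : K != fset0 ->
  exists2 b, (forall x, x \in F -> a x = b x) &
    forall Y, disjoint_translates K Y -> (#|` occurrences w b Y| <= #|` F|)%N.
Proof.
move=> /fset0Pn[k kK]; pose h : K := [` kK]%fset.
exists (fun x => if x \in F then a x else ~~ w h) => [x ->//|Y sep].
apply: leq_trans (card_hitting_points K Y F sep).
apply/fsubset_leq_card/fsubsetP => y; rewrite !inE => /andP[-> /forallP/(_ h)].
case: ifP => [hyF _|_]; last by case: (w h).
by apply/existsP; exists h.
Qed.

End Frequencies.

(** * Generic densities *)

Section Generic.
Context {R : realType} {G : semigroupType} {Phi : nat -> {fset G}}.
Context (cG : cancellative G) (infG : infinite_set [set: G]).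
Context (Phi_Folner : is_Folner R Phi).
Local Open Scope ring_scope.
Local Notation space := (prod_topology (fun _ : G => bool)).

(** The packings eventually outgrow #|F| / e, as F is fixed while Phi n grows.
    Positivity of #|Y| comes along, so that the quotients can be compared. *)
Let small_ratio (K F : {fset G}) (e : R) (N : nat) : 0 < e ->
  exists2 n, (N <= n)%N & forall Y, Y \in max_packings K (Phi n) ->
    (0 < #|` Y|%:R :> R) /\ #|` F|%:R / #|` Y|%:R < e.
Proof.
move=> e0; pose m := (Num.truncn (#|` F|%:R / e : R)).+1.
have [M _ HM] := Folner_large_packings Phi_Folner K m cG infG.
exists (maxn N M); first exact: leq_maxl.
move=> Y /(HM _ (leq_maxr _ _)) mY.
have Y0 : 0 < #|` Y|%:R :> R by rewrite ltr0n (leq_trans _ mY).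
split=> //; rewrite ltr_pdivrMr // mulrC -ltr_pdivrMr //.
by apply: lt_le_trans (truncnS_gt _) _; rewrite ler_nat.
Qed.

(** Controlling a single maximal packing of Phi n is enough, because max_freq is
    a maximum over all of them. *)
Lemma comeager_upper_density (K : {fset G}) (w : {ffun K -> bool}) :
  comeager ([set a | upper_density R Phi w a = 1%E] : set space).
Proof.
apply: (@comeagerS _ (\bigcap_j [set a : space | forall N, exists2 n,
    (N <= n)%N & 1 - j.+1%:R^-1 < max_freq R w a (Phi n)])).
  move=> a Ha; apply: limn_esup_eq => [n|j N]; first exact: max_freq_le1.
  exact: Ha.
apply: comeager_bigcap => [|j]; first exact: countableP.
apply: comeager_frequently => [n|a F N].
  have [F HF] := max_freq_local (R := R) w (Phi n).
  by exists F => a b /HF ->.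
have j0 : 0 < j.+1%:R^-1 :> R by rewrite invr_gt0.
have [n Nn Hn] := small_ratio K F _ N j0.
have [Y maxY] := max_packings_nonempty K (Phi n).
have [/packingP[_ _ sep] _] := max_packingsP _ _ _ maxY.
have [Y0 FY] := Hn Y maxY.
have [b ab cb] := planting w a F Y cG sep.
exists b => //; exists n => //.
apply: lt_le_trans (le_bigmax_seq _ _ _ _ maxY erefl).
rewrite ltrBlDr; apply: (@le_lt_trans _ _
  ((#|` occurrences w b Y| + #|` F|)%:R / #|` Y|%:R)).
  by rewrite ler_pdivlMr // mul1r ler_nat.
by rewrite natrD mulrDl ltrD2l.
Qed.

(** Here every maximal packing has to be controlled, which is why avoiding
    produces one configuration that is good for all packings at once. *)
Lemma comeager_lower_density (K : {fset G}) (w : {ffun K -> bool}) :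
  K != fset0 -> comeager ([set a | lower_density R Phi w a = 0%E] : set space).
Proof.
move=> K0; apply: (@comeagerS _ (\bigcap_j [set a : space | forall N, exists2 n,
    (N <= n)%N & max_freq R w a (Phi n) < j.+1%:R^-1])).
  move=> a Ha; apply: limn_einf_eq => [n|j N]; first exact: max_freq_ge0.
  by rewrite add0r; exact: Ha.
apply: comeager_bigcap => [|j]; first exact: countableP.
apply: comeager_frequently => [n|a F N].
  have [F HF] := max_freq_local (R := R) w (Phi n).
  by exists F => a b /HF ->.
have j0 : 0 < j.+1%:R^-1 :> R by rewrite invr_gt0.
have [n Nn Hn] := small_ratio K F _ N j0.
have [b ab cb] := avoiding w a F K0.
exists b => //; exists n => //; rewrite /max_freq big_seq.
apply: bigmax_lt => // Y maxY.
have [/packingP[_ _ sep] _] := max_packingsP _ _ _ maxY.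
have [Y0 FY] := Hn Y maxY.
by apply: le_lt_trans FY; rewrite ler_pM2r ?invr_gt0 // ler_nat cb.
Qed.

End Generic.

Theorem theorem42 (R : realType) (G : semigroupType) (Phi : nat -> {fset G})
    (G_countable : countable [set: G]) (G_infinite : infinite_set [set: G])
    (G_cancellative : cancellative G) (G_amenable : amenable R G)
    (Phi_Folner : is_Folner R Phi) :
  comeager ([set alpha | ENA R Phi alpha]
            : set (prod_topology (fun _ : G => bool))).
Proof.
pose space : topologicalType := prod_topology (fun _ : G => bool).
refine (@comeagerS space (\bigcap_(K in [set: {fset G}])
    \bigcap_(w in [set: {ffun K -> bool}])
    [set a : space | K != fset0 -> upper_density R Phi w a = 1%E /\
                                   lower_density R Phi w a = 0%E]) _ _ _).
  by move=> a Ha K w; apply: Ha.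
apply: comeager_bigcap => [|K]; first exact: countable_fsetT.
apply: comeager_bigcap => [|w]; first exact: countableP.
case: (boolP (K == fset0)) => [_|K0].
  have denseT : dense ([set: space]) by move=> O [x Ox] _; exists x.
  apply: comeagerS (comeager_open_dense setT openT denseT).
  by move=> a _ /negP[].
apply: comeagerS (comeagerI _ _
  (comeager_upper_density G_cancellative G_infinite Phi_Folner K w)
  (comeager_lower_density G_cancellative G_infinite Phi_Folner K w K0)).
by move=> a [].
Qed.
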